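(* Let $\mathfrak{s}=(s_1,\dots,s_r)\in\mathbb{N}^r$ and $\mathbf{u}=(u_1,\dots,u_r)\in\overline{k}^r$ with $\tilde{\mathbf{u}}\in\mathbb{D}_{\tilde{\mathfrak{s}},\infty}$. Let $\mathbf{x}=(x_{1,1},\dots,x_{1,d_1},\dots,x_{r,1},\dots,x_{r,d_r})^{\mathrm{tr}}\in\mathbb{C}_\infty^d$ with $|x_{m,j}|_\infty<q^{-(d_m-j)+\frac{d_mq}{q-1}}$ for all $1\le m\le r$, $1\le j\le d_m$. Then $|\theta^\ell x_{m,j}|_\infty<q^{\frac{d_mq}{q-1}}$ for $1\le m\le r$, $1\le j\le d_m$, $0\le\ell\le d_m-j$, and $|\theta^\ell x_{m,j}u_{m-1}|_\infty<q^{\frac{d_{m-1}q}{q-1}}$ for $2\le m\le r$, $1\le j\le d_m$, $0\le\ell\le d_m-j$; and the $\mathrm{wt}(\mathfrak{s})$-th coordinate of $\log_{G_{\mathfrak{s},\mathbf{u}}}(\mathbf{x})$ equals $$\sum_{j=1}^{d_1}\sum_{\ell=0}^{d_1-j}(-1)^\ell\binom{d_1-j}{\ell}\theta^{d_1-j-\ell}\mathrm{Li}^\star_{d_1}(\theta^\ell x_{1,j})+\sum_{m=2}^r(-1)^{m-1}\sum_{j=1}^{d_m}\sum_{\ell=0}^{d_m-j}(-1)^\ell\binom{d_m-j}{\ell}\theta^{d_m-j-\ell}\Big\{\mathrm{Li}^\star_{(d_m,s_{m-1},\dots,s_1)}(\theta^\ell x_{m,j},u_{m-1},\dots,u_1)-\mathrm{Li}^\star_{(d_{m-1},s_{m-2},\dots,s_1)}(\theta^\ell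 x_{m,j}u_{m-1},u_{m-2},\dots,u_1)\Big\},$$ where for $m=2$ the last term is $\mathrm{Li}^\star_{(d_1)}(\theta^\ell x_{2,j}u_1)$, and all these series converge $\infty$-adically.
   Context: Let $q$ be a prime power, $A=\mathbb{F}_q[\theta]$, $k=\mathbb{F}_q(\theta)$, $|\theta|_\infty=q$, $\mathbb{C}_\infty$ the completion of an algebraic closure of $k_\infty=\mathbb{F}_q((1/\theta))$, $\overline{k}\subset\mathbb{C}_\infty$ the algebraic closure of $k$. For $\Lambda=(\lambda_1,\dots,\lambda_r)$, $\tilde\Lambda=(\lambda_r,\dots,\lambda_1)$. For $\mathfrak{n}=(n_1,\dots,n_r)\in\mathbb{N}^r$, $\mathbb{D}_{\mathfrak{n},\infty}=\{(z_i)\in\mathbb{C}_\infty^r:|z_1|_\infty<q^{n_1q/(q-1)},|z_i|_\infty\le q^{n_iq/(q-1)}\ (i\ge2)\}$; $\mathrm{wt}(\mathfrak{s})=\sum s_i$. With $L_0=1$, $L_i=\prod_{j=1}^i(\theta-\theta^{q^j})$, $\mathrm{Li}^\star_{\mathfrak{n}}(z_1,\dots,z_r)=\sum_{i_1\ge\cdots\ge i_r\ge0}z_1^{q^{i_1}}\cdots z_r^{q^{i_r}}/(L_{i_1}^{n_1}\cdots L_{i_r}^{n_r})$, which converges on $\mathbb{D}_{\mathfrak{n},\infty}$. A $t$-module over $\overline{k}$ is an $\mathbb{F}_q$-linear ring homomorphism $[\cdot]:\mathbb{F}_q[t]\to\mathrm{Mat}_d(\overline{k})[\tau]$ (twisted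 polynomial ring, $\tau M=M^{(1)}\tau$, $M^{(1)}$ entrywise $q$-th power) with $\partial[t]-\theta I_d$ nilpotent ($\partial$ the $\tau^0$-coefficient). $\exp_G$ is the unique $\mathbb{F}_q$-linear power series with $\exp_G(\mathbf{z})\equiv\mathbf{z}$ mod degree $q$ and $\exp_G\circ\partial[a]=[a]\circ\exp_G$; $\log_G$ is its formal inverse, evaluated $\infty$-adically. $G_{\mathfrak{s},\mathbf{u}}$: $d_m=s_m+\cdots+s_r$, $d=\sum_m d_m$; coordinates indexed by $(m,j)$, $1\le j\le d_m$, lexicographically (so the $\mathrm{wt}(\mathfrak{s})$-th coordinate is $(1,d_1)$); $[t]=\theta I_d+N+E\tau$, $N$ block diagonal whose $d_m\times d_m$ blocks have $1$'s on the superdiagonal, $E$ block upper triangular whose $(m,m')$ block ($m\le m'$) has a single nonzero entry at $(d_m,1)$, equal to $1$ if $m=m'$ and $(-1)^{m'-m}u_m\cdots u_{m'-1}$ if $m<m'$. *)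

(* Defs.v *)
From HB Require Import structures.
From mathcomp Require Import all_boot all_order all_algebra all_field.
From mathcomp Require Import finmap.
From mathcomp Require Import zify.
From mathcomp Require Import boolp classical_sets functions reals exp.

Set Implicit Arguments.
Unset Strict Implicit.
Unset Printing Implicit Defensive.

Import Order.TTheory GRing.Theory Num.Theory.

Local Open Scope ring_scope.

Local Notation "x %:F" := (FracField.tofrac x) : ring_scope.

Section AbsoluteValue.

Variables (R : realType) (K : fieldType) (abs : K -> R).

Definition abs_cvg (v : nat -> K) (l : K) : Prop :=
  forall e : R, 0 < e ->
    exists N : nat, forall n, (N <= n)%N -> abs (v n - l) < e.

Definition abs_cauchy (v : nat -> K) : Prop :=
  forall e : R, 0 < e ->
    exists N : nat, forall m n, (N <= m)%N -> (N <= n)%N -> abs (v m - v n) < e.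

(* Unconditional sum of the family f over the indices satisfying P. Over a
   complete non-archimedean field this exists iff f tends to 0 along the
   cofinite filter, so that no order of summation has to be chosen. *)
Definition has_sum (I : choiceType) (P : pred I) (f : I -> K) (l : K) : Prop :=
  forall e : R, 0 < e ->
    exists A : {fset I}, forall B : {fset I}, (A `<=` B)%fset ->
      abs (\sum_(i <- B | P i) f i - l) < e.

End AbsoluteValue.

Definition algebraic_over_set (K : fieldType) (S : set K) (x : K) : Prop :=
  exists p : {poly K}, [/\ p != 0, (forall i, S p`_i) & root p x].

Section Cinfty.

Variables (R : realType) (F : finFieldType).

Section Laurent.

Variables (K : fieldType) (abs : K -> R).
Variable emb : {rmorphism {fraction {poly F}} -> K}.

(* The image of F((1/theta)): sums of Laurent series
   \sum_(i >= 0) c_i theta^(n-i). *)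
Definition Laurent_at_infty : set K :=
  [set x | exists (n : nat) (c : nat -> F),
    abs_cvg abs
      (fun N => \sum_(i < N) emb ((c i)%:P)%:F * emb ('X%:F) ^+ n
                                / emb ('X%:F) ^+ i) x]%classic.

Definition Laurent_closure : set K :=
  algebraic_over_set Laurent_at_infty.

End Laurent.

(* A completion of an algebraic closure of F((1/theta)), where k is
   {fraction {poly F}}, with theta = 'X. The absolute value is determined on k
   by its value at theta, hence on F((1/theta)), on the algebraic closure
   (uniqueness of extensions over a complete field) and on the completion; so
   this structure is unique up to isometric isomorphism over k. *)
Record Cinfty := MkCinfty {
  Csort :> fieldType;
  Cemb : {rmorphism {fraction {poly F}} -> Csort};
  Cabs : Csort -> R;
  Cabs_ge0 : forall x, 0 <= Cabs x;
  Cabs_eq0 : forall x, Cabs x = 0 <-> x = 0;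
  CabsM : forall x y, Cabs (x * y) = Cabs x * Cabs y;
  CabsD : forall x y, Cabs (x + y) <= Num.max (Cabs x) (Cabs y);
  Cabs_theta : Cabs (Cemb ('X%:F)) = #|F|%:R;
  Cclosed : forall p : {poly Csort},
    (forall i, Laurent_closure Cabs Cemb p`_i) -> (1 < size p)%N ->
    exists x, Laurent_closure Cabs Cemb x /\ root p x;
  Cdense : forall (x : Csort) (e : R), 0 < e ->
    exists y, Laurent_closure Cabs Cemb y /\ Cabs (x - y) < e;
  Ccomplete : forall v : nat -> Csort, abs_cauchy Cabs v ->
    exists l, abs_cvg Cabs v l }.

End Cinfty.

Section Theory.

Variables (R : realType) (F : finFieldType) (C : Cinfty R F).

Local Notation q := #|F|.

Definition theta : C := Cemb C ('X%:F).

Definition Fq_emb (c : F) : C := Cemb C ((c%:P)%:F).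

Definition kbar (x : C) : Prop := algebraicOver (Cemb C) x.

(* q^(nq/(q-1)) *)
Definition radius (n : nat) : R := powR q%:R (n%:R * q%:R / (q%:R - 1)).

Definition in_polydisc (n : seq nat) (z : seq C) : Prop :=
  [/\ size z = size n,
      Cabs (nth 0 z 0) < radius (nth 0%N n 0) &
      forall i, (0 < i < size n)%N ->
        Cabs (nth 0 z i) <= radius (nth 0%N n i)].

Definition Lfactor (i : nat) : C :=
  \prod_(1 <= j < i.+1) (theta - theta ^+ (q ^ j)%N).

Definition Listar_index (n : seq nat) : pred (seq nat) :=
  fun i => (size i == size n) && sorted geq i.

Definition Listar_term (n : seq nat) (z : seq C) (i : seq nat) : C :=
  \prod_(k < size n)
    (nth 0 z k ^+ (q ^ nth 0%N i k)%N / Lfactor (nth 0%N i k) ^+ nth 0%N n k).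

Definition Listar_cvg (n : seq nat) (z : seq C) : Prop :=
  exists l, has_sum (@Cabs _ _ C) (Listar_index n) (Listar_term n z) l.

(* The sum of the series; the default value 0 is used if it diverges. *)
Definition Listar (n : seq nat) (z : seq C) : C :=
  xget 0
    [set l | has_sum (@Cabs _ _ C) (Listar_index n) (Listar_term n z) l]%classic.

Definition twist (m n i : nat) (M : 'M[C]_(m, n)) : 'M[C]_(m, n) :=
  map_mx (fun y => y ^+ (q ^ i)%N) M.

(* Mat_d(C)[[tau]]: f stands for \sum_i f_i tau^i, equivalently for the
   F-linear power series z |-> \sum_i f_i z^(i); composition of such series is
   the product below. *)
Definition tau_series (d : nat) := nat -> 'M[C]_d.

HB.instance Definition _ (d : nat) := GRing.Zmodule.on (tau_series d).

Definition tau_const (d : nat) (M : 'M[C]_d) : tau_series d :=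
  fun n => if n == 0%N then M else 0.

Definition tau_mul (d : nat) (f g : tau_series d) : tau_series d :=
  fun n => \sum_(i < n.+1) f i *m twist i (g (n - i)%N).

Lemma pchar_card i : [pchar C].-nat (q ^ i)%N.
Proof.
have [p p_pr pF] := finPcharP F.
have pC : p \in [pchar C].
  apply: (rmorph_pchar (Cemb C)); apply: (rmorph_pchar (@FracField.tofrac _)).
  exact: (rmorph_pchar (@polyC F)).
by rewrite (eq_pnat _ (pcharf_eq pC)) (card_pprimeChar pF) -expnM pnatX pnat_id.
Qed.

Lemma expC0 i : 0 ^+ (q ^ i)%N = 0 :> C.
Proof.
rewrite expr0n gtn_eqF // expn_gt0; apply/orP; left.
by apply/card_gt0P; exists 0.
Qed.

Lemma twistD m n i : {morph @twist m n i : M M' / M + M'}.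
Proof.
by move=> M M'; apply/matrixP=> a b; rewrite !mxE exprDn_pchar ?pchar_card.
Qed.

Lemma twist0 m n i : @twist m n i 0 = 0.
Proof. by apply/matrixP=> a b; rewrite !mxE expC0. Qed.

Lemma twist_sum m n i (I : Type) (r : seq I) (P : pred I) (M : I -> 'M_(m, n)) :
  twist i (\sum_(k <- r | P k) M k) = \sum_(k <- r | P k) twist i (M k).
Proof. exact: (big_morph _ (@twistD m n i) (@twist0 m n i)). Qed.

Lemma twistM m n p i (M : 'M_(m, n)) (M' : 'M_(n, p)) :
  twist i (M *m M') = twist i M *m twist i M'.
Proof.
apply/matrixP=> a b; rewrite !mxE.
rewrite (big_morph (fun y : C => y ^+ (q ^ i)) (id1 := 0) (op1 := +%R)).
- by apply: eq_bigr => k _; rewrite !mxE exprMn.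
- by move=> y y'; rewrite exprDn_pchar ?pchar_card.
- exact: expC0.
Qed.

Lemma twistK m n i j (M : 'M_(m, n)) : twist i (twist j M) = twist (i + j) M.
Proof. by apply/matrixP=> a b; rewrite !mxE -exprM -expnD addnC. Qed.

Lemma twist_id m n (M : 'M_(m, n)) : twist 0 M = M.
Proof. by apply/matrixP=> a b; rewrite !mxE expr1. Qed.

Lemma twist1 d i : twist i (1%:M : 'M_d) = 1%:M.
Proof.
apply/matrixP=> a b; rewrite !mxE; case: eqP => _; last exact: expC0.
by rewrite expr1n.
Qed.

Section TauRing.

Variable d : nat.

Fact tau_mulA : associative (@tau_mul d).
Proof.
move=> f g h; apply/funext => n; rewrite /tau_mul.
under eq_bigr => i _ do rewrite twist_sum mulmx_sumr.
under [RHS]eq_bigr => i _ do rewrite mulmx_suml.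
pose T i j := f i *m twist i (g j) *m twist (i + j) (h (n - (i + j))%N).
transitivity (\sum_(i < n.+1) \sum_(j < (n - i).+1) T i j).
  apply: eq_bigr => i _; apply: eq_bigr => j _.
  by rewrite twistM twistK mulmxA /T subnDA.
pose S k i := T i (k - i)%N.
transitivity (\sum_(k < n.+1) \sum_(i < k.+1) S k i); last first.
  apply: eq_bigr => k _; apply: eq_bigr => i _.
  by rewrite /S /T subnKC // -ltnS.
transitivity (\sum_(i < n.+1) \sum_(k < n.+1 | (i <= k)%N) S k i); last first.
  rewrite (exchange_big_dep xpredT) //=; apply: eq_bigr => k _.
  rewrite -(big_mkord (fun i => i <= k)%N (S k)).
  rewrite -(big_mkord xpredT (S k)) (@big_nat_widen _ _ _ 0 k.+1 n.+1) //.
apply: eq_bigr => i _.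
rewrite -(big_mkord (fun k => i <= k)%N (S^~ i)) -(big_mkord xpredT (T i)).
rewrite -[RHS]/(\sum_(0 <= k < n.+1 | (i <= k)%N) S k i).
rewrite [RHS](@big_cat_nat _ _ _ i) //=; last exact: ltnW.
rewrite [X in _ = X + _]big_nat_cond [X in _ = X + _]big1 ?add0r; last first.
  by move=> k; case/andP=> /andP[_ ki] ik; move: (leq_trans ki ik); rewrite ltnn.
have le_in : (i <= n)%N by rewrite -ltnS.
rewrite -[in RHS](add0n (val i)) big_addn (subSn le_in).
by apply: eq_big => [k|k _]; rewrite ?leq_addl // /S addnK.
Qed.

Fact tau_mul1 : left_id (tau_const 1%:M) (@tau_mul d).
Proof.
move=> f; apply/funext => n; rewrite /tau_mul big_ord_recl subn0 twist_id mul1mx.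
by rewrite big1 ?addr0 // => i _; rewrite mul0mx.
Qed.

Fact tau_mulr1 : right_id (tau_const 1%:M) (@tau_mul d).
Proof.
move=> f; apply/funext => n; rewrite /tau_mul big_ord_recr /= subnn twist1 mulmx1.
rewrite big1 ?add0r // => i _; rewrite /tau_const subn_eq0 leqNgt ltn_ord /=.
by rewrite twist0 mulmx0.
Qed.

Fact tau_mulDl : left_distributive (@tau_mul d) +%R.
Proof.
move=> f g h; apply/funext => n; apply: etrans (big_split _ _ _ _ _).
by apply: eq_bigr => i _; apply: mulmxDl.
Qed.

Fact tau_mulDr : right_distributive (@tau_mul d) +%R.
Proof.
move=> f g h; apply/funext => n; apply: etrans (big_split _ _ _ _ _).
apply: eq_bigr => i _.
by rewrite -[RHS]mulmxDr -[X in _ = _ *m X]twistD.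
Qed.

HB.instance Definition _ := GRing.Zmodule_isPzRing.Build (tau_series d)
  tau_mulA tau_mul1 tau_mulr1 tau_mulDl tau_mulDr.

Definition tau_eval (f : tau_series d) (x y : 'cV[C]_d) : Prop :=
  forall c : 'I_d,
    has_sum (@Cabs _ _ C) predT (fun i : nat => (f i *m twist i x) c 0) (y c 0).

(* F[t] is {poly F}, with t = 'X; Mat_d(kbar)[tau] is the subring of
   tau_series d cut out by tmod_poly and tmod_kbar. *)
Record tmodule := MkTmodule {
  tmod_act :> {rmorphism {poly F} -> tau_series d};
  tmod_linear : forall (c : F), tmod_act c%:P = tau_const (Fq_emb c)%:M;
  tmod_poly : forall a, exists N : nat, forall n, (N <= n)%N -> tmod_act a n = 0;
  tmod_kbar : forall a n i j, kbar (tmod_act a n i j);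
  tmod_nilp : exists N : nat, (tmod_act 'X 0%N - theta%:M) ^+ N = 0 }.

Definition is_exp (G : tmodule) (e : tau_series d) : Prop :=
  e 0%N = 1%:M /\ forall a : {poly F}, e * tau_const (G a 0%N) = G a * e.

Definition is_log (G : tmodule) (l : tau_series d) : Prop :=
  exists e, [/\ is_exp G e, l * e = 1 & e * l = 1].

End TauRing.

Section Gsu.

Variables (r : nat) (s : r.-tuple nat) (u : r.-tuple C).

(* Blocks and coordinates are numbered from 0: dblock m is d_(m+1). *)
Definition dblock (m : nat) : nat := sumn (drop m s).

Definition dtotal : nat := \sum_(m < r) dblock m.

Definition Nsu : 'M[C]_dtotal :=
  \mxblock_(m < r, m' < r)
    (\matrix_(i < dblock m, j < dblock m')
       ((m == m') && (j == i.+1 :> nat))%:R).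

Definition Esu : 'M[C]_dtotal :=
  \mxblock_(m < r, m' < r)
    (\matrix_(i < dblock m, j < dblock m')
       if [&& (m <= m')%N, i.+1 == dblock m & j == 0%N :> nat]
       then (-1) ^+ (m' - m) * \prod_(m <= k < m') nth 0 u k else 0).

(* [t] = theta I_d + N + E tau *)
Definition tsu : tau_series dtotal :=
  fun n => match n with
           | 0 => theta%:M + Nsu
           | 1 => Esu
           | _ => 0
           end.

Definition xcoord (x : 'cV[C]_dtotal) (m : 'I_r) (j : 'I_(dblock m)) : C :=
  x (tagnat.Rank m j) 0.

End Gsu.

End Theory.

(* Main.v *)
(** Write log = \sum_i P_i tau^i. The functional equation
log * [t] = (theta + N) * log determines the matrices P_i recursively:

  (theta - theta^(q^(i+1))) P_(i+1) = P_(i+1) N - N P_(i+1) + P_i E^(i).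

With the weight R_m / q^(d_m - j) on the column (m, j), where
R_m = q^(d_m q / (q - 1)), this recursion is norm non-increasing, because
|theta - theta^(q^(i+1))| = q^(q^(i+1)) and R_m^q = R_m q^(q d_m); so log
converges wherever the coordinates are smaller than the weights. In the
wt(s)-th row the term N P_(i+1) vanishes, and the recursion is solved in closed
form: the entry at (m, j) is

  (-1)^(m-1) (theta - theta^(q^i))^(d_m - j) / L_i^(d_m) S_i(m),

where S_i(m) is the sum of the terms of the star polylogarithm in
u_(m-1), ..., u_1 with indices i > i_1 >= ... >= i_(m-1). Expanding the power
binomially, and writing the sum over i > i_1 as the sum over i >= i_1 minus the
terms with i = i_1, gives the two families of star polylogarithms. *)

Require Import Defs.
From mathcomp Require Import all_boot all_order all_algebra.
From mathcomp Require Import boolp classical_sets functions reals exp.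
From mathcomp Require Import finmap ring zify.

Set Implicit Arguments.
Unset Strict Implicit.
Unset Printing Implicit Defensive.

Import Order.TTheory GRing.Theory Num.Theory.
Local Open Scope ring_scope.

(** * Ultrametric estimates, convergent series and unordered sums *)

Section Ultrametric.

Variables (R : realType) (F : finFieldType) (C : Cinfty R F).
Implicit Types (x y z : C) (e : R).

Local Notation abs := (@Cabs R F C).

Lemma Cabs0 : abs 0 = 0.
Proof. exact/Cabs_eq0. Qed.

Lemma Cabs_gt0 x : x != 0 -> 0 < abs x.
Proof.
move=> x0; rewrite lt_neqAle Cabs_ge0 andbT eq_sym.
by apply: contra_neq x0; exact: (Cabs_eq0 x).1.
Qed.

Lemma Cabs1 : abs 1 = 1.
Proof.
have n0 : abs 1 != 0 by rewrite gt_eqF // Cabs_gt0 // oner_neq0.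
by apply: (mulfI n0); rewrite -CabsM !mulr1.
Qed.

Lemma CabsX x n : abs (x ^+ n) = abs x ^+ n.
Proof. by elim: n => [|n IHn]; rewrite ?expr0 ?Cabs1 // !exprS CabsM IHn. Qed.

Lemma CabsN x : abs (- x) = abs x.
Proof.
have N1 : abs (-1) = 1.
  by apply/eqP; rewrite -sqrp_eq1 ?Cabs_ge0 // -CabsX sqrrN expr1n Cabs1.
by rewrite -mulN1r CabsM N1 mul1r.
Qed.

Lemma CabsV x : abs x^-1 = (abs x)^-1.
Proof.
have [->|x0] := eqVneq x 0; first by rewrite invr0 Cabs0 invr0.
have ax0 : abs x != 0 by rewrite gt_eqF // Cabs_gt0.
by apply: (mulfI ax0); rewrite -CabsM !mulfV // Cabs1.
Qed.

Lemma CabsD_lt x y e : abs x < e -> abs y < e -> abs (x + y) < e.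
Proof. by move=> xe ye; rewrite (le_lt_trans (CabsD x y)) // gt_max xe. Qed.

Lemma CabsB_lt x y e : abs x < e -> abs y < e -> abs (x - y) < e.
Proof. by move=> xe ye; rewrite CabsD_lt // CabsN. Qed.

Lemma CabsD_le x y e : abs x <= e -> abs y <= e -> abs (x + y) <= e.
Proof. by move=> xe ye; rewrite (le_trans (CabsD x y)) // ge_max xe. Qed.

Lemma CabsB_le x y e : abs x <= e -> abs y <= e -> abs (x - y) <= e.
Proof. by move=> xe ye; rewrite CabsD_le // CabsN. Qed.

(** Were [abs (x - y)] smaller than [abs y], then y = x - (x - y) would be a difference of two
    elements smaller than y. *)
Lemma CabsB_eq x y : abs x < abs y -> abs (x - y) = abs y.
Proof.
move=> xy; apply/eqP; rewrite eq_le CabsB_le ?(ltW xy) //= leNgt.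
apply/negP => xyy; suff : abs y < abs y by rewrite ltxx.
by rewrite -{1}[y](subKr x) CabsB_lt.
Qed.

Lemma Cabs_sum_lt (I : Type) (r : seq I) (P : pred I) (f : I -> C) e :
  0 < e -> (forall i, P i -> abs (f i) < e) -> abs (\sum_(i <- r | P i) f i) < e.
Proof.
move=> e0 fe; elim/big_ind: _ => //; first by rewrite Cabs0.
by move=> x y; exact: CabsD_lt.
Qed.

Lemma Cabs_sum_le (I : Type) (r : seq I) (P : pred I) (f : I -> C) e :
  0 <= e -> (forall i, P i -> abs (f i) <= e) ->
  abs (\sum_(i <- r | P i) f i) <= e.
Proof.
move=> e0 fe; elim/big_ind: _ => //; first by rewrite Cabs0.
by move=> x y; exact: CabsD_le.
Qed.

Lemma Cabs_small x : (forall e, 0 < e -> abs x < e) -> x = 0.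
Proof.
by move=> xs; apply: contrapT => /eqP/Cabs_gt0 /xs; rewrite ltxx.
Qed.

Lemma abs_cvg_unique (v : nat -> C) x y :
  abs_cvg abs v x -> abs_cvg abs v y -> x = y.
Proof.
move=> vx vy; apply/eqP; rewrite -subr_eq0; apply/eqP/Cabs_small => e e0.
have [N Nx] := vx e e0; have [M My] := vy e e0.
rewrite -(subrKA (v (maxn N M))) -(opprB (v _) x) addrC.
by rewrite CabsB_lt ?Nx ?My ?leq_maxl ?leq_maxr.
Qed.

Lemma abs_cvg_cst x : abs_cvg abs (fun=> x) x.
Proof. by move=> e e0; exists 0%N => n _; rewrite subrr Cabs0. Qed.

Lemma abs_cvgD (v w : nat -> C) x y :
  abs_cvg abs v x -> abs_cvg abs w y -> abs_cvg abs (fun n => v n + w n) (x + y).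
Proof.
move=> vx wy e e0; have [N Nx] := vx e e0; have [M My] := wy e e0.
exists (maxn N M) => n; rewrite geq_max => /andP[Nn Mn].
by rewrite opprD addrACA CabsD_lt ?Nx ?My.
Qed.

Lemma abs_cvgMl (v : nat -> C) x y :
  abs_cvg abs v x -> abs_cvg abs (fun n => y * v n) (y * x).
Proof.
move=> vx e e0; have [->|y0] := eqVneq y 0.
  by exists 0%N => n _; rewrite !mul0r subr0 Cabs0.
have [N Nx] := vx (e / abs y) (divr_gt0 e0 (Cabs_gt0 y0)).
by exists N => n /Nx; rewrite -mulrBr CabsM ltr_pdivlMr ?Cabs_gt0 // mulrC.
Qed.

Lemma abs_cvgB (v w : nat -> C) x y :
  abs_cvg abs v x -> abs_cvg abs w y -> abs_cvg abs (fun n => v n - w n) (x - y).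
Proof.
move=> vx /(@abs_cvgMl _ _ (-1)) wy; have := abs_cvgD vx wy.
by rewrite mulN1r; congr abs_cvg; apply/funext => n; rewrite mulN1r.
Qed.

Lemma abs_cvg_sum (I : Type) (r : seq I) (P : pred I) (v : I -> nat -> C)
    (l : I -> C) :
  (forall i, P i -> abs_cvg abs (v i) (l i)) ->
  abs_cvg abs (fun n => \sum_(i <- r | P i) v i n) (\sum_(i <- r | P i) l i).
Proof.
move=> vl; elim: r => [|i r IHr].
  under eq_fun do rewrite big_nil.
  by rewrite big_nil; exact: abs_cvg_cst.
under eq_fun do rewrite big_cons.
rewrite big_cons; case: ifP => [Pi|//].
by apply: abs_cvgD IHr; exact: vl.
Qed.

Definition psum (g : nat -> C) (N : nat) : C := \sum_(n < N) g n.

Lemma psum_cvgD (f g : nat -> C) x y :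
  abs_cvg abs (psum f) x -> abs_cvg abs (psum g) y ->
  abs_cvg abs (psum (fun n => f n + g n)) (x + y).
Proof.
move=> fx gy; congr (abs_cvg abs _ _): (abs_cvgD fx gy).
by apply/funext => N; rewrite /psum big_split.
Qed.

Lemma psum_cvgMl (f : nat -> C) x y :
  abs_cvg abs (psum f) x -> abs_cvg abs (psum (fun n => y * f n)) (y * x).
Proof.
move=> fx; congr (abs_cvg abs _ _): (abs_cvgMl y fx).
by apply/funext => N; rewrite /psum mulr_sumr.
Qed.

Lemma psum_cvgB (f g : nat -> C) x y :
  abs_cvg abs (psum f) x -> abs_cvg abs (psum g) y ->
  abs_cvg abs (psum (fun n => f n - g n)) (x - y).
Proof.
move=> fx gy; congr (abs_cvg abs _ _): (abs_cvgB fx gy).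
by apply/funext => N; rewrite /psum sumrB.
Qed.

Lemma psum_cvg_sum (I : Type) (r : seq I) (P : pred I) (f : I -> nat -> C)
    (l : I -> C) :
  (forall i, P i -> abs_cvg abs (psum (f i)) (l i)) ->
  abs_cvg abs (psum (fun n => \sum_(i <- r | P i) f i n)) (\sum_(i <- r | P i) l i).
Proof.
move=> /(abs_cvg_sum r) fl; congr (abs_cvg abs _ _): fl.
by apply/funext => N; rewrite /psum exchange_big.
Qed.

Lemma psum_tail_lt (g : nat -> C) e N n : 0 < e ->
  (forall k, (N <= k)%N -> abs (g k) < e) -> (N <= n)%N ->
  abs (psum g n - psum g N) < e.
Proof.
move=> e0 ge; elim: n => [|n IHn]; first by rewrite leqn0 => /eqP->; rewrite subrr Cabs0.
rewrite leq_eqVlt => /predU1P[<-|]; first by rewrite subrr Cabs0.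
rewrite ltnS => Nn; rewrite /psum big_ord_recr /= addrAC.
by apply: CabsD_lt; [exact: IHn | exact: ge].
Qed.

(** A difference of partial sums is no larger than its largest term, so a null sequence has Cauchy
    partial sums, and the field is complete. *)
Lemma null_psum_cvg (g : nat -> C) :
  abs_cvg abs g 0 -> exists l, abs_cvg abs (psum g) l.
Proof.
move=> g0; apply: Ccomplete => e e0; have [N Ne] := g0 e e0.
have tail n : (N <= n)%N -> abs (psum g n - psum g N) < e.
  by apply: psum_tail_lt => // k /Ne; rewrite subr0.
exists N => m n Nm Nn; rewrite -(subrKA (psum g N)) -[X in _ + X]opprB.
by apply: CabsB_lt; exact: tail.
Qed.

Lemma has_sum_unique (I : choiceType) (P : pred I) (f : I -> C) x y :
  has_sum abs P f x -> has_sum abs P f y -> x = y.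
Proof.
move=> fx fy; apply/eqP; rewrite -subr_eq0; apply/eqP/Cabs_small => e e0.
have [A Ax] := fx e e0; have [B By] := fy e e0.
pose S := \sum_(i <- (A `|` B)%fset | P i) f i.
rewrite -(subrKA S) -(opprB S x) addrC.
by rewrite CabsB_lt ?Ax ?By ?fsubsetUl ?fsubsetUr.
Qed.

(* Since the absolute value is ultrametric, the terms outside the finitely many
   fibers of h below N contribute less than e to any finite sum. *)
Lemma has_sum_fibers (I : choiceType) (P : pred I) (h : I -> nat)
    (fib : nat -> seq I) (f : I -> C) x :
  (forall n, uniq (fib n)) ->
  (forall n i, (i \in fib n) = P i && (h i == n)) ->
  (forall e, 0 < e -> exists N, forall i, P i -> (N <= h i)%N -> abs (f i) < e) ->
  abs_cvg abs (psum (fun n => \sum_(i <- fib n) f i)) x ->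
  has_sum abs P f x.
Proof.
move=> fib_uniq mem_fib f0 fx e e0.
have [N1 fN1] := f0 e e0; have [N2 fN2] := fx e e0; pose N := maxn N1 N2.
(* The witness is the union of the fibers over 0, ..., N - 1. A set B containing it splits into
   these fibers, which give the N-th partial sum, and a rest made of small terms. *)
exists [fset i in flatten [seq fib n | n <- iota 0 N]]%fset => B /fsubsetP AB.
have BN M : (M <= N)%N ->
    \sum_(i <- B | P i && (h i < M)%N) f i = psum (fun n => \sum_(i <- fib n) f i) M.
  elim: M => [_|M IHM MN].
    by rewrite /psum big_ord0 big_pred0 // => i; rewrite ltn0 andbF.
  rewrite /psum big_ord_recr /= -[X in X + _]IHM 1?ltnW //.
  rewrite (bigID (fun i => h i < M)%N) /=; congr (_ + _).
    apply: eq_bigl => i; rewrite -andbA; congr (_ && _).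
    by apply: andb_idl => /ltnW.
  rewrite -big_filter; apply: perm_big; apply: uniq_perm => //.
    by rewrite filter_uniq // fset_uniq.
  move=> i; rewrite mem_filter mem_fib -leqNgt ltnS -[X in X && _]andbA -eqn_leq.
  apply: andb_idr => /andP[Pi hi]; apply: AB; rewrite in_fset.
  apply/flattenP; exists (fib M); last by rewrite mem_fib Pi.
  by apply: map_f; rewrite mem_iota.
rewrite (bigID (fun i => h i < N)%N) /= BN // addrAC.
apply: CabsD_lt; first by apply: fN2; rewrite leq_maxr.
apply: Cabs_sum_lt => // i /andP[Pi]; rewrite -leqNgt => Ni.
by apply: fN1 => //; rewrite (leq_trans _ Ni) ?leq_maxl.
Qed.

Lemma has_sum_nat (g : nat -> C) x :
  abs_cvg abs g 0 -> abs_cvg abs (psum g) x -> has_sum abs predT g x.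
Proof.
move=> g0 gx; apply: (@has_sum_fibers _ _ id (fun n => [:: n])) => //.
- by move=> n i; rewrite inE.
- by move=> e /g0[N gN]; exists N => i _ /gN; rewrite subr0.
- congr (abs_cvg abs (psum _) x): gx.
  by apply/funext => n; rewrite big_seq1.
Qed.

End Ultrametric.

(** Serves as the common majorant of all the series below, whose terms are bounded by K x^(q^n). *)
Lemma expr_null (R : realType) (K x e : R) (q : nat) :
  (1 < q)%N -> 0 <= K -> 0 <= x < 1 -> 0 < e ->
  exists N, forall n, (N <= n)%N -> K * x ^+ (q ^ n)%N < e.
Proof.
move=> q1 K0 /andP[x0 x1] e0.
(* A Bernoulli-type inequality: x^n <= 1 / (1 + n (1 - x)). *)
have bern n : (1 + n%:R * (1 - x)) * x ^+ n <= 1.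
  elim: n => [|n IHn]; first by rewrite mul0r addr0 mul1r.
  apply: le_trans IHn; rewrite exprS mulrA ler_wpM2r ?exprn_ge0 // -subr_ge0.
  rewrite [X in 0 <= X](_ : _ = n.+1%:R * (1 - x) ^+ 2); last first.
    by rewrite -natr1; ring.
  by rewrite mulr_ge0 ?ler0n // sqr_ge0.
have d0 : 0 < (1 - x) * e by rewrite mulr_gt0 // subr_gt0.
(* Beyond this index K < n (1 - x) e, and q^n >= n carries the estimate over to the exponent q^n. *)
exists (Num.Def.archi_bound (K / ((1 - x) * e))) => n Nn.
set m := (q ^ n)%N.
have m0 : (0 < m)%N by rewrite expn_gt0 ltnW.
have nm : (n <= m)%N by rewrite ltnW // ltn_expl.
have Km : K < m%:R * ((1 - x) * e).
  rewrite -ltr_pdivrMr //; apply: lt_le_trans (archi_boundP _) _.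
    by rewrite divr_ge0 // ltW.
  by rewrite ler_nat (leq_trans Nn).
have c0 : 0 < 1 + m%:R * (1 - x) by rewrite ltr_pwDl // mulr_ge0 // subr_ge0 ltW.
rewrite -(ltr_pM2r c0) -mulrA [x ^+ m * _]mulrC.
apply: le_lt_trans (ler_wpM2l K0 (bern m)) _.
by rewrite mulr1 (lt_le_trans Km) // mulrA mulrC ler_wpM2l ?(ltW e0) // lerDr.
Qed.

(** * Arithmetic of the radii of convergence *)

Section Radius.

Variables (R : realType) (F : finFieldType).
Local Notation q := #|F|.
Local Notation qR := (#|F|%:R : R).

Lemma card_gt1 : (1 < q)%N. Proof. exact: card_finNzRing_gt1. Qed.

Lemma cardR_gt1 : 1 < qR. Proof. by rewrite ltr1n card_gt1. Qed.

Lemma cardR_gt0 : 0 < qR. Proof. exact: lt_trans ltr01 cardR_gt1. Qed.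

Lemma radius_gt0 n : 0 < radius R F n.
Proof. by rewrite powR_gt0 // cardR_gt0. Qed.

Lemma radiusD m n : radius R F (m + n) = radius R F m * radius R F n.
Proof.
by rewrite /radius natrD 2!mulrDl powRD // (gt_eqF cardR_gt0) implybT.
Qed.

(** Since q * nq/(q-1) = nq/(q-1) + nq, the q-th power of the radius is the radius times q^(nq).
    Raising this to the power q^i gives the claim. *)
Lemma radius_expS n i :
  radius R F n ^+ (q ^ i.+1)%N = radius R F n ^+ (q ^ i)%N * qR ^+ (n * q ^ i.+1).
Proof.
have q0 : qR != 0 by rewrite gt_eqF // cardR_gt0.
have q10 : qR - 1 != 0 by rewrite subr_eq0 gt_eqF // cardR_gt1.
have -> : radius R F n ^+ (q ^ i.+1)%N = (radius R F n * qR ^+ (n * q)) ^+ (q ^ i)%N.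
  rewrite expnS exprM; congr (_ ^+ _).
  rewrite -!powR_mulrn ?powR_ge0 ?ler0n // -powRrM -powRD ?q0 ?implybT //.
  congr powR.
  by rewrite natrM; field.
by rewrite exprMn -exprM -mulnA -expnS.
Qed.

(** Turns the real exponent in the hypothesis on the coordinates into the quotient used for the
    weights. *)
Lemma powR_radius k n :
  powR qR (- k%:R + n%:R * qR / (qR - 1)) = radius R F n / qR ^+ k.
Proof.
rewrite powRD ?(gt_eqF cardR_gt0) ?implybT // powRN powR_mulrn ?ltW ?cardR_gt0 //.
by rewrite mulrC.
Qed.

End Radius.

(** * Star polylogarithms as series over their first index *)

Section StarSums.

Variables (R : realType) (F : finFieldType) (C : Cinfty R F).
Local Notation q := #|F|.
Local Notation qR := (#|F|%:R : R).
Local Notation abs := (@Cabs R F C).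
Local Notation theta := (theta C).
Implicit Types (a h k : nat) (n : seq nat) (b : C) (z : seq C).

Lemma Cabs_thetaE : abs theta = qR. Proof. exact: Cabs_theta. Qed.

Lemma Cabs_thetaB i : abs (theta - theta ^+ (q ^ i.+1)%N) = qR ^+ (q ^ i.+1)%N.
Proof.
rewrite CabsB_eq CabsX Cabs_thetaE // -[ltLHS]expr1 ltr_eXn2l ?cardR_gt1 //.
by rewrite (leq_ltn_trans _ (ltn_expl _ (card_gt1 F))).
Qed.

Lemma thetaB_neq0 i : theta - theta ^+ (q ^ i.+1)%N != 0.
Proof.
apply/eqP => /(congr1 abs); rewrite Cabs_thetaB Cabs0 => /eqP.
by rewrite gt_eqF // exprn_gt0 // cardR_gt0.
Qed.

Lemma Lfactor0 : Lfactor C 0 = 1.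
Proof. by rewrite /Lfactor big_geq. Qed.

Lemma LfactorS i : Lfactor C i.+1 = Lfactor C i * (theta - theta ^+ (q ^ i.+1)%N).
Proof. by rewrite /Lfactor big_nat_recr. Qed.

Lemma Lfactor_neq0 i : Lfactor C i != 0.
Proof.
elim: i => [|i IHi]; first by rewrite Lfactor0 oner_neq0.
by rewrite LfactorS mulf_neq0 // thetaB_neq0.
Qed.

(** Both sides satisfy the same recursion in i: the new factor of L_(i+1)^a has absolute value q^(a
    q^(i+1)). *)
Lemma radius_Lfactor a i :
  radius R F a ^+ (q ^ i)%N = radius R F a * abs (Lfactor C i) ^+ a.
Proof.
elim: i => [|i IHi]; first by rewrite expn0 Lfactor0 Cabs1 expr1n mulr1.
rewrite radius_expS IHi LfactorS CabsM Cabs_thetaB exprMn -mulrA.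
by rewrite -exprM [(q ^ _ * a)%N]mulnC.
Qed.

(** Shows that a factor tends to 0 when b lies in the open disc and stays bounded by the radius when
    b lies in the closed one. *)
Lemma Cabs_Listar_factor a b i :
  abs (b ^+ (q ^ i)%N / Lfactor C i ^+ a)
    = radius R F a * (abs b / radius R F a) ^+ (q ^ i)%N.
Proof.
have r0 := radius_gt0 R F a.
have L0 : abs (Lfactor C i) != 0 by rewrite gt_eqF // Cabs_gt0 // Lfactor_neq0.
rewrite CabsM CabsV !CabsX expr_div_n radius_Lfactor.
by rewrite [RHS]mulrCA invfM mulVKf // gt_eqF.
Qed.

Lemma Listar_term_cons a n b z h t :
  Listar_term (a :: n) (b :: z) (h :: t)
    = b ^+ (q ^ h)%N / Lfactor C h ^+ a * Listar_term n z t.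
Proof. by rewrite /Listar_term big_ord_recl. Qed.

(** The finitely many tails compatible with a first index h; they make the inner sums finite once
    the first index is fixed. *)
Fixpoint star_indices k h : seq (seq nat) :=
  if k is k'.+1 then [seq i :: t | i <- iota 0 h.+1, t <- star_indices k' i]
  else [:: [::]].

Lemma mem_star_indices k h t :
  (t \in star_indices k h) = (size t == k) && path geq h t.
Proof.
elim: k h t => [|k IHk] h t; first by case: t.
apply/idP/idP => [/allpairsPdep[i [t' [+ + ->]]]|].
  by rewrite mem_iota ltnS /= IHk eqSS => -> /andP[-> ->].
case: t => // i t /andP[st /andP[ih it]].
by apply/allpairsPdep; exists i, t; rewrite mem_iota IHk -eqSS st.
Qed.

Lemma star_indices_uniq k h : uniq (star_indices k h).
Proof.
elim: k h => // k IHk h; apply: allpairs_uniq_dep => //; first exact: iota_uniq.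
by move=> [i t] [i' t'] _ _ /= [-> ->].
Qed.

Definition star_sum n z h : C :=
  \sum_(t <- star_indices (size n) h) Listar_term n z t.

Lemma star_sum_nil z h : star_sum [::] z h = 1.
Proof. by rewrite /star_sum big_seq1 /Listar_term big_ord0. Qed.

Lemma star_sum_cons a n b z h :
  star_sum (a :: n) (b :: z) h
    = \sum_(i < h.+1) b ^+ (q ^ i)%N / Lfactor C i ^+ a * star_sum n z i.
Proof.
rewrite {1}/star_sum [LHS]big_allpairs_dep -[iota 0 h.+1]/(index_iota 0 h.+1) big_mkord.
apply: eq_bigr => i _; rewrite mulr_sumr; apply: eq_bigr => t _.
exact: Listar_term_cons.
Qed.

Lemma Cabs_Listar_term_le n z t :
  (forall k, (k < size n)%N -> abs (nth 0 z k) <= radius R F (nth 0%N n k)) ->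
  abs (Listar_term n z t) <= \prod_(k < size n) radius R F (nth 0%N n k).
Proof.
move=> zn; rewrite /Listar_term (big_morph abs (@CabsM _ _ C) (Cabs1 C)).
apply: ler_prod => k _; rewrite Cabs_ge0 /= Cabs_Listar_factor.
have r0 := radius_gt0 R F (nth 0%N n k).
rewrite -[leRHS]mulr1 ler_pM2l // exprn_ile1 ?divr_ge0 ?Cabs_ge0 ?(ltW r0) //.
by rewrite ler_pdivrMr // mul1r zn.
Qed.

(** The strict bound on the first variable gives decay in the first index h, uniformly in the other
    indices, whose factors are bounded on the closed discs. Grouping by h therefore turns the
    unordered sum into an ordinary series. *)
Lemma Listar_cvgP a n b z :
  abs b < radius R F a ->
  (forall k, (k < size n)%N -> abs (nth 0 z k) <= radius R F (nth 0%N n k)) ->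
  Listar_cvg (a :: n) (b :: z) /\
  abs_cvg abs (psum (fun h => b ^+ (q ^ h)%N / Lfactor C h ^+ a * star_sum n z h))
    (Listar (a :: n) (b :: z)).
Proof.
move=> ba zn; have r0 := radius_gt0 R F a.
pose B := radius R F a * \prod_(k < size n) radius R F (nth 0%N n k).
have P0 : 0 <= \prod_(k < size n) radius R F (nth 0%N n k).
  by apply: prodr_ge0 => k _; rewrite ltW // radius_gt0.
have B0 : 0 <= B by rewrite mulr_ge0 // ltW.
pose rho := abs b / radius R F a.
have rho1 : 0 <= rho < 1.
  by rewrite divr_ge0 ?Cabs_ge0 ?(ltW r0) //= ltr_pdivrMr // mul1r.
have bound h t : abs (Listar_term (a :: n) (b :: z) (h :: t)) <= B * rho ^+ (q ^ h)%N.
  rewrite Listar_term_cons CabsM Cabs_Listar_factor /B [leRHS]mulrAC ler_wpM2l //.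
    by rewrite mulr_ge0 ?exprn_ge0 ?(ltW r0) //; case/andP: rho1.
  exact: Cabs_Listar_term_le.
pose g h := \sum_(t <- star_indices (size n) h) Listar_term (a :: n) (b :: z) (h :: t).
have gE : g = fun h => b ^+ (q ^ h)%N / Lfactor C h ^+ a * star_sum n z h.
  apply/funext => h; rewrite mulr_sumr; apply: eq_bigr => t _.
  exact: Listar_term_cons.
rewrite -gE.
have [l gl] : exists l, abs_cvg abs (psum g) l.
  apply: null_psum_cvg => e e0.
  have [N Ne] := expr_null (card_gt1 F) B0 rho1 e0.
  exists N => h Nh; rewrite subr0; apply: Cabs_sum_lt => // t _.
  exact: le_lt_trans (bound _ _) (Ne _ Nh).
have suml : has_sum abs (Listar_index (a :: n)) (Listar_term (a :: n) (b :: z)) l.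
  (* The fibers are those of the first index. *)
  apply: (@has_sum_fibers _ _ _ _ _ (head 0%N)
            (fun h => [seq h :: t | t <- star_indices (size n) h])).
  - by move=> h; rewrite map_inj_uniq ?star_indices_uniq // => ? ? [].
  - move=> h i; rewrite /Listar_index; apply/mapP/idP => [[t + ->]|].
      by rewrite mem_star_indices /= eqSS eqxx andbT.
    case: i => [|i t] //=; rewrite eqSS => /andP[it /eqP <-].
    by exists t => //; rewrite mem_star_indices.
  - move=> e e0; have [N Ne] := expr_null (card_gt1 F) B0 rho1 e0.
    exists N => -[|h t] //= _ Nh; exact: le_lt_trans (bound _ _) (Ne _ Nh).
  - by under eq_fun do rewrite big_map.
split; first by exists l.
(* By uniqueness of the sum, [xget] returns [l] and not its default value 0. *)
suff -> : Listar (a :: n) (b :: z) = l by [].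
by apply: xget_unique => // l' /has_sum_unique; apply.
Qed.

End StarSums.

(** * The functional equation of the logarithm *)

Section LogRecursion.

Variables (R : realType) (F : finFieldType) (C : Cinfty R F).
Local Notation q := #|F|.

(** Multiply the equation of the exponential, e * [tau_const] (G 'X 0) = G 'X * e, by l on both
    sides and cancel with l * e = e * l = 1. *)
Lemma is_log_commutes d (G : tmodule C d) (l : tau_series C d) :
  is_log G l -> l * G 'X = tau_const (G 'X 0%N) * l.
Proof.
move=> [e [[_ eG] le el]].
by rewrite -[LHS]mulr1 -el mulrA -(mulrA l) -eG mulrA le mul1r.
Qed.

Lemma is_log0 d (G : tmodule C d) (l : tau_series C d) : is_log G l -> l 0%N = 1%:M.
Proof.
move=> [e [[e0 _] le _]]; have /(congr1 (fun f => f 0%N)) := le.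
by rewrite /GRing.mul /= /tau_mul big_ord1 subnn e0 twist1 mulmx1.
Qed.

Lemma tau_const_mulE d (A : 'M[C]_d) (f : tau_series C d) n :
  (tau_const A * f) n = A *m f n.
Proof.
rewrite /GRing.mul /= /tau_mul big_ord_recl subn0 twist_id big1 ?addr0 //.
by move=> i _; rewrite mul0mx.
Qed.

End LogRecursion.

(** * The matrices N and E in block coordinates, and the recursion for the coefficients *)

Section Coordinates.

Variables (R : realType) (F : finFieldType) (C : Cinfty R F).
Variables (r : nat) (s : r.-tuple nat) (u : r.-tuple C).
Local Notation q := #|F|.
Local Notation abs := (@Cabs R F C).
Local Notation dblock := (dblock s).
Local Notation Rank m j := (@tagnat.Rank r (fun i : 'I_r => dblock i) m j).
Implicit Types (m : 'I_r) (A : 'M[C]_(dtotal s)) (c : 'I_(dtotal s)).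

Lemma dblockS k : (k < r)%N -> dblock k = (nth 0%N s k + dblock k.+1)%N.
Proof. by move=> kr; rewrite /Defs.dblock (drop_nth 0%N) ?size_tuple. Qed.

Lemma sum_Rank (f : 'I_(dtotal s) -> C) :
  \sum_c f c = \sum_(m < r) \sum_(j < dblock m) f (Rank m j).
Proof.
rewrite (reindex (@tagnat.rank r (fun i : 'I_r => dblock i))) /=.
  rewrite sig_big_dep /=; by apply: eq_bigr => p _; rewrite tagnat.rankE.
exact: tagnat.rank_bij_on.
Qed.

Lemma NsuE m m' (j : 'I_(dblock m)) (j' : 'I_(dblock m')) :
  Nsu C s (Rank m j) (Rank m' j') = ((m == m') && (j' == j.+1 :> nat))%:R.
Proof.
pose B (a b : 'I_r) : 'M[C]_(dblock a, dblock b) :=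
  \matrix_(i < dblock a, k < dblock b) ((a == b) && (k == i.+1 :> nat))%:R.
by have := congr1 (fun M : 'M_(_, _) => M j j') (mxblockK B m m'); rewrite !mxE.
Qed.

(** For a <= b, the entry of the block (a, b) of E in its last row and first column. The arguments
    are natural numbers to allow induction on b. *)
Definition usign (a b : nat) : C :=
  (-1) ^+ (b - a) * \prod_(a <= k < b) nth 0 u k.

Lemma EsuE m m' (j : 'I_(dblock m)) (j' : 'I_(dblock m')) :
  Esu s u (Rank m j) (Rank m' j') =
    if [&& (m <= m')%N, j.+1 == dblock m & j' == 0%N :> nat] then usign m m' else 0.
Proof.
pose B (a b : 'I_r) : 'M[C]_(dblock a, dblock b) :=
  \matrix_(i < dblock a, k < dblock b)
    if [&& (a <= b)%N, i.+1 == dblock a & k == 0%N :> nat] then usign a b else 0.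
by have := congr1 (fun M : 'M_(_, _) => M j j') (mxblockK B m m'); rewrite !mxE.
Qed.

Lemma mulmxN_succ A c m (j j' : 'I_(dblock m)) :
  j = j'.+1 :> nat -> (A *m Nsu C s) c (Rank m j) = A c (Rank m j').
Proof.
move=> jj'; rewrite mxE sum_Rank (bigD1 m) //= (bigD1 j') //=.
rewrite NsuE eqxx jj' eqxx mulr1 !big1 ?addr0 // => [m' m'm|k kj'].
  by rewrite big1 // => k _; rewrite NsuE (negPf m'm) mulr0.
by rewrite NsuE jj' eqxx eqSS /= eq_sym (inj_eq val_inj) (negPf kj') mulr0.
Qed.

Lemma mulmxN_first A c m (j : 'I_(dblock m)) :
  j = 0%N :> nat -> (A *m Nsu C s) c (Rank m j) = 0.
Proof.
move=> j0; rewrite mxE sum_Rank big1 // => m' _; rewrite big1 // => k _.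
by rewrite NsuE j0 andbF mulr0.
Qed.

Lemma mulNmx_succ A c m (j j' : 'I_(dblock m)) :
  j' = j.+1 :> nat -> (Nsu C s *m A) (Rank m j) c = A (Rank m j') c.
Proof.
move=> jj'; rewrite mxE sum_Rank (bigD1 m) //= (bigD1 j') //=.
rewrite NsuE eqxx jj' eqxx mul1r !big1 ?addr0 // => [m' m'm|k kj'].
  by rewrite big1 // => k _; rewrite NsuE eq_sym (negPf m'm) mul0r.
by rewrite NsuE eqxx -jj' /= (inj_eq val_inj) (negPf kj') mul0r.
Qed.

Lemma mulNmx_last A c m (j : 'I_(dblock m)) :
  j.+1 = dblock m -> (Nsu C s *m A) (Rank m j) c = 0.
Proof.
move=> jd; rewrite mxE sum_Rank big1 // => m' _; rewrite big1 // => k _.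
rewrite NsuE jd; case: eqP => [mm'|_]; last by rewrite mul0r.
by rewrite ltn_eqF ?mul0r // mm'.
Qed.

Section LogCoefficients.

Hypothesis dblock_gt0 : forall m, (0 < dblock m)%N.

Lemma dblock_predn_lt m : ((dblock m).-1 < dblock m)%N.
Proof. by rewrite ltn_predL. Qed.

Definition block_last m : 'I_(dblock m) := Ordinal (dblock_predn_lt m).

Lemma block_last_succ m : (block_last m).+1 = dblock m.
Proof. exact: prednK. Qed.

(** The entry of A E^(i) in row c and the first column of block b, the only column of that block
    where the product can be nonzero. *)
Definition Ecol (A : 'M[C]_(dtotal s)) i c (b : nat) : C :=
  \sum_(m < r | (m <= b)%N) A c (Rank m (block_last m)) * usign m b ^+ (q ^ i)%N.

Lemma mulmx_twistE A i c m (j : 'I_(dblock m)) :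
  (A *m twist i (Esu s u)) c (Rank m j) = if j == 0%N :> nat then Ecol A i c m else 0.
Proof.
rewrite mxE sum_Rank; under eq_bigr do under eq_bigr do rewrite mxE EsuE.
case: ifP => [/eqP j0|j0]; last first.
  by rewrite big1 // => k _; rewrite big1 // => k' _; rewrite !andbF expC0 mulr0.
rewrite /Ecol [RHS]big_mkcond; apply: eq_bigr => k _.
rewrite (bigD1 (block_last k)) //= big1 ?addr0 => [|k' k'last].
  by rewrite prednK // eqxx !andbT; case: ifP => // _; rewrite expC0 mulr0.
rewrite ifF ?expC0 ?mulr0 //; apply/negP => /and3P[_ /eqP kd _].
move/eqP: k'last; apply; apply: val_inj; apply: succn_inj.
by rewrite kd block_last_succ.
Qed.

(** Passing from b to b + 1 multiplies every earlier [usign] by -u_b and adds the diagonal block. *)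
Lemma EcolS A i c (b : nat) (br : (b.+1 < r)%N) (m := Ordinal br) :
  Ecol A i c b.+1 =
    A c (Rank m (block_last m)) - nth 0 u b ^+ (q ^ i)%N * Ecol A i c b.
Proof.
rewrite /Ecol (bigD1 m) //= /usign subnn mul1r big_geq // expr1n mulr1.
congr (_ + _); rewrite mulr_sumr -sumrN; apply: eq_big => [k|k /andP[km kb]].
  by rewrite -val_eqE /= -[RHS]ltnS [RHS]ltn_neqAle andbC.
have {km}kb : (k <= b)%N by rewrite -ltnS ltn_neqAle kb.
rewrite subSn // big_nat_recr //= exprS mulN1r.
(* The power q^i of the characteristic is additive, hence commutes with the sign, also in
   characteristic 2. *)
rewrite !mulNr exprNn_pchar ?pchar_card // mulrN; congr (- _).
by rewrite !exprMn; ring.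
Qed.

Variables (P : tau_series C (dtotal s)).
Hypothesis PX : P * tsu s u = tau_const (tsu s u 0%N) * P.

(** Compare coefficients of tau^(i+1): [t] has only the terms theta + N and E tau, and N is fixed by
    the twist because its entries are 0 and 1. *)
Lemma log_coef_rec i :
  (theta C - theta C ^+ (q ^ i.+1)%N) *: P i.+1 =
    P i.+1 *m Nsu C s - Nsu C s *m P i.+1 + P i *m twist i (Esu s u).
Proof.
have := congr1 (fun f => f i.+1) PX; rewrite tau_const_mulE.
rewrite [X in X = _ -> _]/GRing.mul /= /tau_mul 2!big_ord_recr /=.
rewrite big1 ?add0r => [|k _]; last first.
  (* For k < i the index i + 1 - k is at least 2, where [tsu] vanishes. *)
  rewrite subSn ?(ltnW (ltn_ord k)) // -(@prednK (i - k)) ?subn_gt0 //=.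
  by rewrite twist0 mulmx0.
rewrite subnn subSn // subnn /= twistD mulmxDr mulmxDl.
have -> : twist i.+1 (theta C)%:M = (theta C ^+ (q ^ i.+1)%N)%:M :> 'M_(dtotal s).
  apply/matrixP => a b; rewrite !mxE; case: eqP => _ //; exact: expC0.
have -> : twist i.+1 (Nsu C s) = Nsu C s.
  apply/matrixP => a b; rewrite mxE -(tagnat.sig2K a) -(tagnat.sig2K b) NsuE.
  by case: (_ && _); rewrite ?expr1n ?expC0.
rewrite mul_mx_scalar mul_scalar_mx scalerBl => /esym/(canRL (addrK _))->.
by rewrite addrAC addrCA (addrC (_ *: _)) addrK [RHS]addrAC [X in _ = X - _]addrC.
Qed.

Lemma log_coef_recE i c m (j : 'I_(dblock m)) :
  (theta C - theta C ^+ (q ^ i.+1)%N) * P i.+1 c (Rank m j) =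
    (P i.+1 *m Nsu C s) c (Rank m j) - (Nsu C s *m P i.+1) c (Rank m j)
      + (if j == 0%N :> nat then Ecol (P i) i c m else 0).
Proof.
have := congr1 (fun M : 'M_(dtotal s) => M c (Rank m j)) (log_coef_rec i).
by rewrite -mulmx_twistE => E; rewrite mxE in E; rewrite E !mxE.
Qed.

End LogCoefficients.
End Coordinates.

(** * Growth of the coefficients and convergence of the logarithm *)

Section LogBound.

Variables (R : realType) (F : finFieldType) (C : Cinfty R F).
Variables (r : nat) (s : r.-tuple nat) (u : r.-tuple C).
Local Notation q := #|F|.
Local Notation qR := (#|F|%:R : R).
Local Notation abs := (@Cabs R F C).
Local Notation dblock := (dblock s).
Local Notation Rank m j := (@tagnat.Rank r (fun i : 'I_r => dblock i) m j).
Implicit Types (m : 'I_r) (c : 'I_(dtotal s)).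

Hypothesis dblock_gt0 : forall m, (0 < dblock m)%N.
Hypothesis u_le : forall k, (k < r)%N -> abs (nth 0 u k) <= radius R F (nth 0%N s k).

(** The radii telescope: by d_k = s_k + d_(k+1), the radius of d_k is the product of those of s_k
    and d_(k+1), and u_k is bounded by the radius of s_k. *)
Lemma Cabs_usign_le a b : (a <= b <= r)%N ->
  abs (usign u a b) * radius R F (dblock b) <= radius R F (dblock a).
Proof.
case/andP; elim: b => [|b IHb].
  by rewrite leqn0 => /eqP-> _; rewrite /usign subnn big_geq // mulr1 Cabs1 mul1r.
rewrite leq_eqVlt => /predU1P[-> _|].
  by rewrite /usign subnn big_geq // mulr1 Cabs1 mul1r.
rewrite ltnS => ab br; apply: le_trans (IHb ab (ltnW br)).
rewrite (dblockS _ br) radiusD mulrA ler_wpM2r ?(ltW (radius_gt0 _ _ _)) //.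
rewrite /usign subSn // big_nat_recr //= exprS mulN1r mulrA !mulNr CabsN CabsM.
by rewrite ler_wpM2l ?Cabs_ge0 ?u_le.
Qed.

(** The bound that the theorem puts on the coordinate (m, j); with j counted from 0, the exponent is
    d_m - (j + 1). *)
Definition coef_weight m (j : 'I_(dblock m)) : R :=
  radius R F (dblock m) / qR ^+ (dblock m - j.+1).

Lemma coef_weight_gt0 m (j : 'I_(dblock m)) : 0 < coef_weight j.
Proof. by rewrite divr_gt0 ?radius_gt0 // exprn_gt0 // cardR_gt0. Qed.

Lemma coef_weight_succ m (j j' : 'I_(dblock m)) :
  j' = j.+1 :> nat -> coef_weight j' = coef_weight j * qR.
Proof.
move=> j'j; rewrite /coef_weight j'j -(subnSK (_ : j.+1 < dblock m)%N) -?j'j //.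
rewrite exprS; have := cardR_gt0 R F => /gt_eqF/negbT q0.
by field; rewrite q0 expf_neq0.
Qed.

Lemma coef_weight_last m : coef_weight (block_last dblock_gt0 m) = radius R F (dblock m).
Proof. by rewrite /coef_weight block_last_succ subnn divr1. Qed.

(** The denominator has exponent (d_m - 1) q^(i+1), against d_m q^(i+1) from the radius. The factor
    left over is the absolute value of theta - theta^(q^(i+1)). *)
Lemma coef_weight_first m (j : 'I_(dblock m)) i : j = 0%N :> nat ->
  coef_weight j ^+ (q ^ i.+1)%N = radius R F (dblock m) ^+ (q ^ i)%N * qR ^+ (q ^ i.+1)%N.
Proof.
move=> j0; rewrite /coef_weight j0 subn1 expr_div_n radius_expS -mulrA; congr (_ * _).
have := cardR_gt0 R F => /gt_eqF/negbT q0.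
rewrite -exprM -[X in qR ^+ (X * _)](prednK (dblock_gt0 m)) mulSn exprD.
by rewrite mulfK // expf_neq0.
Qed.

Variables (P : tau_series C (dtotal s)).
Hypothesis P0 : P 0%N = 1%:M.
Hypothesis PX : P * tsu s u = tau_const (tsu s u 0%N) * P.

(** A crude majorant of all weights, as the case i = 0 with P_0 = 1 requires. *)
Definition log_bound : R := 1 + \sum_(m < r) \sum_(j < dblock m) coef_weight j.

Lemma log_bound_ge0 : 0 <= log_bound.
Proof.
rewrite addr_ge0 // sumr_ge0 // => m _; rewrite sumr_ge0 // => j _.
exact/ltW/coef_weight_gt0.
Qed.

Lemma coef_weight_le m (j : 'I_(dblock m)) : coef_weight j <= log_bound.
Proof.
rewrite /log_bound (bigD1 m) //= (bigD1 j) //= -[leLHS]add0r lerD ?ler01 //.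
rewrite -addrA lerDl addr_ge0 // sumr_ge0 // => k _.
  exact/ltW/coef_weight_gt0.
by rewrite sumr_ge0 // => k' _; exact/ltW/coef_weight_gt0.
Qed.

(* Multiplying the recursion by the weights, which satisfy
   coef_weight j.+1 = coef_weight j * q and, for j = 0,
   coef_weight j ^ (q^(i+1)) = (radius d_m) ^ (q^i) * q ^ (q^(i+1)),
   each of its three terms is bounded by an earlier instance of the claim. *)
Lemma log_coef_le i c m (j : 'I_(dblock m)) :
  abs (P i c (Rank m j)) * coef_weight j ^+ (q ^ i)%N <= log_bound.
Proof.
elim: i c m j => [|i IHi] c m j.
  rewrite P0 mxE expr1; apply: le_trans (coef_weight_le j).
  case: eqP => _; rewrite ?Cabs1 ?mul1r // Cabs0 mul0r.
  exact/ltW/coef_weight_gt0.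
rewrite -(tagnat.sig2K c); move: (tagnat.sig1 c) (tagnat.sig2 c) => {c} a b.
(* The induction is lexicographic: N P_(i+1) refers to the next row of the same block, so the
   distance to the end of the block drops; P_(i+1) N refers to the preceding column in the same row,
   so j drops. *)
have [n] := ubnP (dblock a - b); elim: n a b m j => // n IHn a b m j ban.
have [k] := ubnP (val j); elim: k m j => // k IHk m j jk.
set Q := (q ^ i.+1)%N.
have qQ : 0 < qR ^+ Q by rewrite exprn_gt0 // cardR_gt0.
have qQ1 : 1 <= qR ^+ Q by rewrite exprn_ege1 // ltW // cardR_gt1.
have w0 k' : 0 <= coef_weight j ^+ k' by rewrite exprn_ge0 // ltW // coef_weight_gt0.
have B0 := log_bound_ge0.
rewrite -(ler_pM2l qQ) mulrA -[X in X * _ * _](Cabs_thetaB C i) -CabsM.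
rewrite (log_coef_recE dblock_gt0 PX).
suff bound z : abs z * coef_weight j ^+ Q <= qR ^+ Q * log_bound ->
     abs z <= qR ^+ Q * log_bound / coef_weight j ^+ Q.
  rewrite -ler_pdivlMr ?exprn_gt0 ?coef_weight_gt0 //.
  apply: CabsD_le; first apply: CabsB_le; apply: bound.
  - have [j0|j0] := posnP j.
      by rewrite (mulmxN_first _ _ j0) Cabs0 mul0r mulr_ge0 // ltW.
    have j'd : (j.-1 < dblock m)%N by rewrite (leq_ltn_trans (leq_pred j)).
    have jj' : j = (Ordinal j'd).+1 :> nat by rewrite /= prednK.
    rewrite (mulmxN_succ _ _ jj') (coef_weight_succ jj') exprMn mulrA mulrC.
    rewrite ler_wpM2l ?(ltW qQ) //; apply: IHk.
    by rewrite -ltnS -jj'.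
  - have [bd|bd] := eqVneq b.+1 (dblock a).
      by rewrite (mulNmx_last _ _ bd) Cabs0 mul0r mulr_ge0 // ltW.
    have b'd : (b.+1 < dblock a)%N by rewrite ltn_neqAle bd ltn_ord.
    rewrite (@mulNmx_succ _ _ _ _ _ _ _ _ _ (Ordinal b'd)) //.
    apply: le_trans (_ : log_bound <= _); last by rewrite ler_peMl.
    by apply: IHn; rewrite /= -ltnS (leq_trans _ ban) // subnSK.
  - case: eqP => [j0|_]; last by rewrite Cabs0 mul0r mulr_ge0 // ltW.
    rewrite coef_weight_first // mulrA mulrC ler_wpM2l ?(ltW qQ) //.
    have rm0 : 0 < radius R F (dblock m) ^+ (q ^ i)%N.
      by rewrite exprn_gt0 // radius_gt0.
    rewrite -ler_pdivlMr //; apply: Cabs_sum_le => [|m' m'm].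
      by rewrite divr_ge0 // ltW.
    rewrite ler_pdivlMr // CabsM CabsX.
    apply: le_trans (IHi (Rank a b) m' (block_last dblock_gt0 m')).
    rewrite -mulrA ler_wpM2l ?Cabs_ge0 // coef_weight_last -exprMn.
    by rewrite lerXn2r ?nnegrE ?mulr_ge0 ?Cabs_ge0 ?(ltW (radius_gt0 _ _ _)) //
         Cabs_usign_le // m'm ltnW.
by rewrite ler_pdivlMr // exprn_gt0 // coef_weight_gt0.
Qed.

(** With rho the ratio of the coordinate to its weight, [log_coef_le] bounds each summand by
    [log_bound] times rho^(q^i). *)
Lemma log_term_null (x : 'cV[C]_(dtotal s)) c :
  (forall m (j : 'I_(dblock m)), abs (xcoord x j) < coef_weight j) ->
  abs_cvg abs (fun i => (P i *m twist i x) c 0) 0.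
Proof.
move=> xlt; under eq_fun do rewrite mxE sum_Rank.
suff : abs_cvg abs (fun i => \sum_(m < r) \sum_(j < dblock m)
    P i c (Rank m j) * twist i x (Rank m j) 0) (\sum_(m < r) \sum_(j < dblock m) 0).
  by rewrite [X in abs_cvg _ _ X]big1 // => m _; rewrite big1.
apply: abs_cvg_sum => m _; apply: abs_cvg_sum => j _ e e0.
have w0 := coef_weight_gt0 j.
pose rho := abs (xcoord x j) / coef_weight j.
have rho1 : 0 <= rho < 1.
  by rewrite divr_ge0 ?Cabs_ge0 ?(ltW w0) //= ltr_pdivrMr // mul1r.
have [N Ne] := expr_null (card_gt1 F) log_bound_ge0 rho1 e0.
exists N => i /Ne; apply: le_lt_trans; rewrite subr0 mxE CabsM CabsX.
have -> : abs (x (Rank m j) 0) = coef_weight j * rho.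
  by rewrite mulrC mulfVK // gt_eqF.
rewrite exprMn mulrA ler_wpM2r ?log_coef_le // exprn_ge0 //.
by case/andP: rho1.
Qed.

End LogBound.

(** * Closed form of the wt(s)-th row *)

Section TopRow.

Variables (R : realType) (F : finFieldType) (C : Cinfty R F).
Variables (r : nat) (s : r.+1.-tuple nat) (u : r.+1.-tuple C).
Local Notation q := #|F|.
Local Notation dblock := (dblock s).
Local Notation Rank m j := (@tagnat.Rank r.+1 (fun i : 'I_r.+1 => dblock i) m j).
Local Notation theta := (theta C).

Hypothesis dblock_gt0 : forall m : 'I_r.+1, (0 < dblock m)%N.

Definition top_coord : 'I_(dtotal s) := Rank ord0 (block_last dblock_gt0 ord0).

Lemma top_coordE : top_coord.+1 = sumn s.
Proof.
rewrite /top_coord tagnat.RankEsum big_pred0 ?add0n => [|k]; last by rewrite ltn0.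
by rewrite block_last_succ /Defs.dblock drop0.
Qed.

(* The star sum over i > i_1 >= ... >= i_m, whose outer inequality is strict. *)
Definition strict_star_sum (m i : nat) : C :=
  if i is i'.+1 then star_sum (rev (take m s)) (rev (take m u)) i' else (m == 0%N)%:R.

Lemma strict_star_sum0 i : strict_star_sum 0 i = 1.
Proof. by case: i => //= i; rewrite !take0 star_sum_nil. Qed.

Lemma star_sum_take m i : (m < r.+1)%N ->
  star_sum (rev (take m.+1 s)) (rev (take m.+1 u)) i =
    \sum_(k < i.+1) nth 0 u m ^+ (q ^ k)%N / Lfactor C k ^+ nth 0%N s m
      * star_sum (rev (take m s)) (rev (take m u)) k.
Proof.
move=> mr; rewrite (take_nth 0%N) ?size_tuple // (take_nth 0) ?size_tuple //.
by rewrite !rev_rcons star_sum_cons.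
Qed.

(** Splits the index tuples by whether i_1 < i or i_1 = i. For i = 0 the first part is empty, in
    line with the value 0 of [strict_star_sum] there. *)
Lemma strict_star_sumS m i : (m < r.+1)%N ->
  strict_star_sum m.+1 i.+1 = strict_star_sum m.+1 i
    + nth 0 u m ^+ (q ^ i)%N / Lfactor C i ^+ nth 0%N s m * strict_star_sum m i.+1.
Proof.
move=> mr; rewrite /= star_sum_take // big_ord_recr /=; congr (_ + _).
by case: i => [|i] /=; rewrite ?big_ord0 // star_sum_take.
Qed.

Variables (P : tau_series C (dtotal s)).
Hypothesis P0 : P 0%N = 1%:M.
Hypothesis PX : P * tsu s u = tau_const (tsu s u 0%N) * P.

(** With d_m = s_m + d_(m+1), the recursion [EcolS] becomes [strict_star_sumS]; this moves the
    strict bound from i to i + 1. *)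
Lemma Ecol_top i :
  (forall m : 'I_r.+1, P i top_coord (Rank m (block_last dblock_gt0 m))
     = (-1) ^+ m / Lfactor C i ^+ dblock m * strict_star_sum m i) ->
  forall m, (m < r.+1)%N -> Ecol u dblock_gt0 (P i) i top_coord m =
    (-1) ^+ m / Lfactor C i ^+ dblock m * strict_star_sum m i.+1.
Proof.
move=> Pi; elim=> [|m IHm] mr.
  rewrite /Ecol (bigD1 ord0) //= big1 ?addr0 => [|k /andP[k0 kn0]]; last first.
    by move: kn0; rewrite -val_eqE /= -leqn0 k0.
  by rewrite Pi /usign big_geq // !mulr1 expr1n mulr1 strict_star_sum0 !take0 star_sum_nil.
rewrite EcolS Pi IHm 1?ltnW // strict_star_sumS 1?ltnW //= -/(strict_star_sum m i.+1).
rewrite (dblockS s (ltnW mr)) exprD exprS mulN1r.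
have L0 k : Lfactor C i ^+ k != 0 by rewrite expf_neq0 // Lfactor_neq0.
by field; rewrite !L0.
Qed.

(** In this row N P_(i+1) vanishes, so each step to the preceding column absorbs one factor theta -
    theta^(q^(i+1)); after j + 1 factors only the contribution of E remains. *)
Lemma top_row_step i (m : 'I_r.+1) (j : 'I_(dblock m)) :
  P i.+1 top_coord (Rank m j) * (theta - theta ^+ (q ^ i.+1)%N) ^+ j.+1
    = Ecol u dblock_gt0 (P i) i top_coord m.
Proof.
have [n] := ubnP (val j); elim: n m j => // n IHn m j jn.
have := log_coef_recE dblock_gt0 PX i top_coord j.
rewrite mulNmx_last ?block_last_succ // subr0 exprS mulrA [_ * (_ - _)]mulrC => ->.
have [j0|j0] := posnP j; first by rewrite mulmxN_first // j0 add0r mulr1.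
have j'd : (j.-1 < dblock m)%N by rewrite (leq_ltn_trans (leq_pred j)).
have [j' jj'] : exists j' : 'I_(dblock m), j = j'.+1 :> nat.
  by exists (Ordinal j'd); rewrite /= prednK.
by rewrite (mulmxN_succ _ _ jj') addr0 jj' IHn // -ltnS -jj'.
Qed.

Lemma top_row i (m : 'I_r.+1) (j : 'I_(dblock m)) :
  P i top_coord (Rank m j) =
    (-1) ^+ m / Lfactor C i ^+ dblock m
      * (theta - theta ^+ (q ^ i)%N) ^+ (dblock m - j.+1) * strict_star_sum m i.
Proof.
elim: i m j => [|i IHi] m j.
  (* At i = 0 the base theta - theta^(q^0) is 0, and 0^0 = 1 singles out the last column of a block;
     the strict sum is 0 outside the first block. This is the row of the identity matrix. *)
  rewrite P0 mxE Lfactor0 expr1n divr1 expn0 expr1 subrr expr0n.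
  rewrite -val_eqE /= tagnat.eq_Rank; case: m j => [[|m] mr] j /=; last first.
    by rewrite mulr0.
  rewrite mulr1 mul1r; congr (nat_of_bool _)%:R.
  by have /= := ltn_ord j; lia.
have Pi k : P i top_coord (Rank k (block_last dblock_gt0 k))
     = (-1) ^+ k / Lfactor C i ^+ dblock k * strict_star_sum k i.
  by rewrite IHi block_last_succ subnn mulr1.
have D0 k : (theta - theta ^+ (q ^ i.+1)%N) ^+ k != 0.
  by rewrite expf_neq0 // thetaB_neq0.
apply: (mulIf (D0 j.+1)); rewrite top_row_step (Ecol_top Pi) // LfactorS exprMn.
have jd : (dblock m - j.+1 + j.+1)%N = dblock m by rewrite subnK.
rewrite [RHS]mulrAC -[X in _ = X * _]mulrA -exprD jd; congr (_ * _).
have L0 : Lfactor C i ^+ dblock m != 0 by rewrite expf_neq0 // Lfactor_neq0.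
by field; rewrite L0 D0.
Qed.

End TopRow.

(** * Bounds on the arguments and passage to star polylogarithms *)

Section Radii.

Variables (R : realType) (F : finFieldType) (C : Cinfty R F).
Variables (r : nat) (s : r.+1.-tuple nat) (u : r.+1.-tuple C).
Local Notation q := #|F|.
Local Notation abs := (@Cabs R F C).

Lemma dblock_pos : (forall m : 'I_r.+1, (0 < tnth s m)%N) ->
  forall m : 'I_r.+1, (0 < dblock s m)%N.
Proof.
by move=> s_gt0 m; rewrite dblockS // -(tnth_nth 0%N s m) addn_gt0 s_gt0.
Qed.

Lemma in_polydisc_rev_le : in_polydisc (rev s) (rev u) ->
  forall k, (k < r.+1)%N -> abs (nth 0 u k) <= radius R F (nth 0%N s k).
Proof.
move=> [_ u0 ui] k kr.
have rk : (r - k < r.+1)%N by rewrite ltnS leq_subr.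
have <- : nth 0 (rev u) (r - k) = nth 0 u k.
  by rewrite nth_rev ?size_tuple // subSS subKn.
have <- : nth 0%N (rev s) (r - k) = nth 0%N s k.
  by rewrite nth_rev ?size_tuple // subSS subKn.
have [->|rk0] := posnP (r - k)%N; first exact: ltW.
by apply: ui; rewrite rk0 size_rev size_tuple.
Qed.

Hypothesis u_le : forall k, (k < r.+1)%N -> abs (nth 0 u k) <= radius R F (nth 0%N s k).

Lemma rev_take_le m k : (m <= r.+1)%N -> (k < size (rev (take m s)))%N ->
  abs (nth 0 (rev (take m u)) k) <= radius R F (nth 0%N (rev (take m s)) k).
Proof.
move=> mr; rewrite size_rev size_takel ?size_tuple // => km.
rewrite !nth_rev ?size_takel ?size_tuple // !nth_take ?ltn_subrL ?(leq_ltn_trans _ km) //.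
by apply: u_le; rewrite (leq_trans _ mr) // ltn_subrL (leq_ltn_trans _ km).
Qed.

Section Argument.

Variables (m : 'I_r.+1) (j : 'I_(dblock s m)) (y : C).
Hypothesis y_lt : abs y < coef_weight R F j.

(** The power of theta contributes at most the denominator of the weight. *)
Lemma Cabs_theta_mul_lt l : (l <= dblock s m - j.+1)%N ->
  abs (theta C ^+ l * y) < radius R F (dblock s m).
Proof.
move=> lj; rewrite CabsM CabsX Cabs_thetaE.
have q0 := cardR_gt0 R F.
apply: le_lt_trans (_ : #|F|%:R ^+ (dblock s m - j.+1) * abs y < _).
  by rewrite ler_wpM2r ?Cabs_ge0 // ler_weXn2l // ltW // cardR_gt1.
by rewrite mulrC -ltr_pdivlMr // exprn_gt0.
Qed.

Lemma Cabs_theta_mulu_lt l : (0 < m)%N -> (l <= dblock s m - j.+1)%N ->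
  abs (theta C ^+ l * y * nth 0 u m.-1) < radius R F (dblock s m.-1).
Proof.
move=> m0 lj; have mr : (m.-1 < r.+1)%N by rewrite (leq_ltn_trans (leq_pred m)).
rewrite dblockS // prednK // radiusD CabsM mulrC.
apply: le_lt_trans (_ : radius R F (nth 0%N s m.-1) * abs (theta C ^+ l * y) < _).
  by rewrite ler_wpM2r ?Cabs_ge0 ?u_le.
by rewrite ltr_pM2l ?radius_gt0 // Cabs_theta_mul_lt.
Qed.

End Argument.

Lemma Listar_take_cvgP m d (b : C) : (m <= r.+1)%N -> abs b < radius R F d ->
  Listar_cvg (d :: rev (take m s)) (b :: rev (take m u)) /\
  abs_cvg abs (psum (fun i => b ^+ (q ^ i)%N / Lfactor C i ^+ d
                                * star_sum (rev (take m s)) (rev (take m u)) i))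
    (Listar (d :: rev (take m s)) (b :: rev (take m u))).
Proof. by move=> mr bd; apply: Listar_cvgP => // k; exact: rev_take_le. Qed.

(** The sum over i > i_1 is the sum over i >= i_1 minus the terms with i_1 = i. In the latter the
    power of u_(m-1) merges with that of b, and s_(m-1) + d_m = d_(m-1), blocks being numbered from
    0. *)
Lemma strict_star_sum_diff (m : nat) (b : C) i : (0 < m < r.+1)%N ->
  b ^+ (q ^ i)%N / Lfactor C i ^+ dblock s m * strict_star_sum s u m i =
    b ^+ (q ^ i)%N / Lfactor C i ^+ dblock s m
      * star_sum (rev (take m s)) (rev (take m u)) i
    - (b * nth 0 u m.-1) ^+ (q ^ i)%N / Lfactor C i ^+ dblock s m.-1
      * star_sum (rev (take m.-1 s)) (rev (take m.-1 u)) i.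
Proof.
case: m => // m; rewrite /= => mr.
rewrite -[star_sum (rev (take m.+1 s)) _ i]/(strict_star_sum s u m.+1 i.+1).
rewrite strict_star_sumS 1?ltnW // (dblockS s (ltnW mr)) exprMn exprD /=.
have L0 k : Lfactor C i ^+ k != 0 by rewrite expf_neq0 // Lfactor_neq0.
by field; rewrite !L0.
Qed.

(** Binomial expansion; theta^(l q^i) is then absorbed into the q^i-th power of theta^l b. *)
Lemma thetaB_exprM (k i : nat) (b : C) (t : C) d :
  t / Lfactor C i ^+ d * (theta C - theta C ^+ (q ^ i)%N) ^+ k * b ^+ (q ^ i)%N
  = t * \sum_(l < k.+1) (-1) ^+ l * 'C(k, l)%:R * theta C ^+ (k - l)
      * ((theta C ^+ l * b) ^+ (q ^ i)%N / Lfactor C i ^+ d).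
Proof.
rewrite exprBn -!mulrA; congr (t * _).
rewrite mulr_suml mulr_sumr; apply: eq_bigr => l _.
by rewrite -mulr_natr exprMn -!exprM [(q ^ i * l)%N]mulnC; ring.
Qed.

End Radii.

(** * The logarithm formula *)

Theorem theorem4p2 (R : realType) (F : finFieldType) (C : Cinfty R F)
    (r : nat) (s : r.+1.-tuple nat) (u : r.+1.-tuple C)
    (s_gt0 : forall m : 'I_r.+1, (0 < tnth s m)%N)
    (u_alg : forall m : 'I_r.+1, kbar (tnth u m))
    (u_disc : in_polydisc (rev s) (rev u))
    (G : tmodule C (dtotal s)) (G_t : G 'X = tsu s u)
    (logG : tau_series C (dtotal s)) (logGP : is_log G logG)
    (x : 'cV[C]_(dtotal s))
    (x_disc : forall (m : 'I_r.+1) (j : 'I_(dblock s m)),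
       Cabs (xcoord x j) <
         powR #|F|%:R (- (dblock s m - j.+1)%:R
                       + (dblock s m)%:R * #|F|%:R / (#|F|%:R - 1))) :
  [/\ forall (m : 'I_r.+1) (j : 'I_(dblock s m)) (l : nat),
        (l <= dblock s m - j.+1)%N ->
        Cabs (theta C ^+ l * xcoord x j) < radius R F (dblock s m),
      forall (m : 'I_r.+1) (j : 'I_(dblock s m)) (l : nat),
        (0 < m)%N -> (l <= dblock s m - j.+1)%N ->
        Cabs (theta C ^+ l * xcoord x j * nth 0 u m.-1)
          < radius R F (dblock s m.-1),
      forall (m : 'I_r.+1) (j : 'I_(dblock s m)) (l : nat),
        (l <= dblock s m - j.+1)%N ->
        Listar_cvg (dblock s m :: rev (take m s))
                   (theta C ^+ l * xcoord x j :: rev (take m u)),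
      forall (m : 'I_r.+1) (j : 'I_(dblock s m)) (l : nat),
        (0 < m)%N -> (l <= dblock s m - j.+1)%N ->
        Listar_cvg (dblock s m.-1 :: rev (take m.-1 s))
                   (theta C ^+ l * xcoord x j * nth 0 u m.-1
                      :: rev (take m.-1 u)) &
      exists (y : 'cV[C]_(dtotal s)) (c : 'I_(dtotal s)),
        [/\ tau_eval logG x y,
            c.+1 = sumn s &
            y c 0 =
              \sum_(j < dblock s (@ord0 r))
               \sum_(l < (dblock s (@ord0 r) - j.+1).+1)
                 (-1) ^+ l * 'C(dblock s (@ord0 r) - j.+1, l)%:R
                 * theta C ^+ (dblock s (@ord0 r) - j.+1 - l)
                 * Listar [:: dblock s (@ord0 r)] [:: theta C ^+ l * xcoord x j]
              + \sum_(m < r.+1 | (0 < m)%N) (-1) ^+ m *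
                \sum_(j < dblock s m)
                 \sum_(l < (dblock s m - j.+1).+1)
                   (-1) ^+ l * 'C(dblock s m - j.+1, l)%:R
                   * theta C ^+ (dblock s m - j.+1 - l)
                   * (Listar (dblock s m :: rev (take m s))
                             (theta C ^+ l * xcoord x j :: rev (take m u))
                      - Listar (dblock s m.-1 :: rev (take m.-1 s))
                               (theta C ^+ l * xcoord x j * nth 0 u m.-1
                                  :: rev (take m.-1 u)))]].

Proof.
have dpos := dblock_pos s_gt0.
have ule := in_polydisc_rev_le u_disc.
have ltr1 (m : 'I_r.+1) : (m.-1 <= r.+1)%N by rewrite (leq_trans (leq_pred m)) // ltnW.
have xw (m : 'I_r.+1) (j : 'I_(dblock s m)) : Cabs (xcoord x j) < coef_weight R F j.
  by rewrite /coef_weight -powR_radius.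
have zlt (m : 'I_r.+1) (j : 'I_(dblock s m)) (l : nat) :
    (l <= dblock s m - j.+1)%N ->
    Cabs (theta C ^+ l * xcoord x j) < radius R F (dblock s m).
  by move=> lj; apply: Cabs_theta_mul_lt lj; exact: xw.
have zult (m : 'I_r.+1) (j : 'I_(dblock s m)) (l : nat) :
    (0 < m)%N -> (l <= dblock s m - j.+1)%N ->
    Cabs (theta C ^+ l * xcoord x j * nth 0 u m.-1) < radius R F (dblock s m.-1).
  by move=> m0 lj; apply: (Cabs_theta_mulu_lt ule _ m0 lj); exact: xw.
split=> // [m j l lj|m j l m0 lj|].
- by have [] := Listar_take_cvgP ule (ltnW (ltn_ord m)) (zlt m j l lj).
- by have [] := Listar_take_cvgP ule (ltr1 m) (zult m j l m0 lj).
have P0 := is_log0 logGP.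
have PX := is_log_commutes logGP; rewrite G_t in PX.
pose g c i := (logG i *m twist i x) c 0.
have g0 c : abs_cvg (@Cabs _ _ C) (g c) 0 := log_term_null dpos ule P0 PX c xw.
have [y gy] := choice (fun c => null_psum_cvg (g0 c)).
exists (\col_c y c), (top_coord dpos); split.
- by move=> c; rewrite mxE; exact: has_sum_nat (g0 c) (gy c).
- exact: top_coordE.
(* The coordinate is the limit of the partial sums of [g], so it suffices that they also converge to
   the asserted expression. *)
rewrite mxE; apply: abs_cvg_unique (gy _) _.
pose coef (m : 'I_r.+1) (j : 'I_(dblock s m)) (l : nat) : C :=
  (-1) ^+ l * 'C(dblock s m - j.+1, l)%:R * theta C ^+ (dblock s m - j.+1 - l).
pose h (m : 'I_r.+1) (j : 'I_(dblock s m)) (l i : nat) : C :=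
  (theta C ^+ l * xcoord x j) ^+ (#|F| ^ i)%N / Lfactor C i ^+ dblock s m
    * strict_star_sum s u m i.
have -> : g (top_coord dpos) = fun i =>
    \sum_(j < dblock s (@ord0 r)) \sum_(l < (dblock s (@ord0 r) - j.+1).+1)
      coef ord0 j l * h ord0 j l i
    + \sum_(m < r.+1 | (0 < m)%N) (-1) ^+ m *
        \sum_(j < dblock s m) \sum_(l < (dblock s m - j.+1).+1)
          coef m j l * h m j l i.
  apply/funext => i; rewrite /g mxE sum_Rank.
  transitivity (\sum_(m < r.+1) (-1) ^+ m * \sum_(j < dblock s m)
      \sum_(l < (dblock s m - j.+1).+1) coef m j l * h m j l i).
    apply: eq_bigr => m _; rewrite mulr_sumr; apply: eq_bigr => j _.
    rewrite (top_row dpos P0 PX) mxE mulrAC thetaB_exprM -mulrA; congr (_ * _).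
    rewrite mulr_suml; apply: eq_bigr => l _.
    by rewrite /coef /h !mulrA.
  rewrite (bigD1 ord0) //= mul1r; congr (_ + _).
  by apply: eq_bigl => m; rewrite lt0n.
apply: psum_cvgD.
  (* In the first block the strict sum is 1, which leaves a polylogarithm in one variable. *)
  apply: psum_cvg_sum => j _; apply: psum_cvg_sum => l _; apply: psum_cvgMl.
  have [_ ] := Listar_take_cvgP (m := 0%N) ule isT (zlt ord0 j l (ltn_ord l)).
  rewrite !take0; congr (abs_cvg _ (psum _) _); apply/funext => i.
  by rewrite /h strict_star_sum0 star_sum_nil.
apply: psum_cvg_sum => m m0; apply: psum_cvgMl.
apply: psum_cvg_sum => j _; apply: psum_cvg_sum => l _; apply: psum_cvgMl.
have lj : (l <= dblock s m - j.+1)%N by rewrite -ltnS.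
have -> : h m j l = fun i => (theta C ^+ l * xcoord x j) ^+ (#|F| ^ i)%N
      / Lfactor C i ^+ dblock s m * star_sum (rev (take m s)) (rev (take m u)) i
    - (theta C ^+ l * xcoord x j * nth 0 u m.-1) ^+ (#|F| ^ i)%N
      / Lfactor C i ^+ dblock s m.-1
      * star_sum (rev (take m.-1 s)) (rev (take m.-1 u)) i.
  by apply/funext => i; rewrite /h strict_star_sum_diff // m0 ltn_ord.
apply: psum_cvgB.
  by have [] := Listar_take_cvgP ule (ltnW (ltn_ord m)) (zlt m j l lj).
by have [] := Listar_take_cvgP ule (ltr1 m) (zult m j l m0 lj).
Qed.
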